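(* (i) Each Banach Lie algebra $\mathcal{L}$ has complete, lower finite-gap chains of closed Lie ideals between $\mathcal{L}$ and $P_{\mathfrak{J}}(\mathcal{L})$, and of closed Lie subalgebras between $\mathcal{L}$ and $P_{\mathfrak{S}}(\mathcal{L})$. (ii) Each separable Banach Lie algebra $\mathcal{L}$ has a sequence $\{J_{n}\}_{n=1}^{\infty}$ of closed Lie ideals of finite codimension and a sequence $\{L_{n}\}_{n=1}^{\infty}$ of closed Lie subalgebras of finite codimension such that $$J_{n+1}\subseteq J_{n}\ \text{ and }\ \bigcap_{n=1}^{\infty}J_{n}=P_{\mathfrak{J}}(\mathcal{L});\qquad L_{n+1}\subseteq L_{n}\ \text{ and }\ \bigcap_{n=1}^{\infty}L_{n}=P_{\mathfrak{S}}(\mathcal{L}).$$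
   Context: A Banach Lie algebra is a complex Lie algebra $\mathcal{L}$ which is a Banach space in some norm such that, for some constant $t_{\mathcal{L}}>0$, $\|[a,b]\|\leq t_{\mathcal{L}}\|a\|\|b\|$ for all $a,b\in\mathcal{L}$. $P_{\mathfrak{J}}(\mathcal{L})$ (respectively $P_{\mathfrak{S}}(\mathcal{L})$) is the intersection of all proper closed Lie ideals (respectively, proper closed Lie subalgebras) of finite codimension in $\mathcal{L}$, and is $\mathcal{L}$ if there are none. For a non-empty family $G$ of closed subspaces of a Banach space put $\mathfrak{p}(G)=\bigcap_{Y\in G}Y$ and $\mathfrak{s}(G)=\overline{\sum_{Y\in G}Y}$. $G$ is complete if $\mathfrak{p}(G')\in G$ and $\mathfrak{s}(G')\in G$ for every $\varnothing\neq G'\subseteq G$. $G$ is a lower finite-gap family if for each $Z\in G$ with $Z\neq\mathfrak{p}(G)$ there is $Y\in G$ with $Y\subset Z$ and $0<\dim(Z/Y)<\infty$. A chain is a family of closed subspaces linearly ordered by inclusion; a lower finite-gap chain is a chain which is a lower finite-gap family. A complete chain $C$ is between $W$ and $V$ (with $V\subseteq W$) if $\mathfrak{p}(C)=V$ and $\mathfrak{s}(C)=W$. *)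

(* Defs.v *)
From HB Require Import structures.
From mathcomp Require Import all_boot all_order all_algebra.
From mathcomp Require Import sesquilinear.
From mathcomp Require Import complex.
From mathcomp Require Import all_classical all_reals all_analysis.

Set Implicit Arguments.
Unset Strict Implicit.
Unset Printing Implicit Defensive.

Import Order.TTheory GRing.Theory Num.Theory.
Import numFieldNormedType.Exports.

Local Open Scope classical_set_scope.
Local Open Scope complex_scope.
Local Open Scope ring_scope.

(* The norm of a [completeNormedModType R[i]] takes its values in [R[i]]; the
   order of [R[i]] is partial, and [0 < t] forces [t] to be real.  *)

Record banach_lie_bracket (R : realType) (L : completeNormedModType R[i])
    (br : {bilinear L -> L -> L}) : Prop := BanachLieBracket {
  bracket_alternating : forall a : L, br a a = 0;
  bracket_jacobi : forall a b c : L,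
    br a (br b c) + br b (br c a) + br c (br a b) = 0;
  bracket_bounded : exists2 t : R[i], 0 < t &
    forall a b : L, `|br a b| <= t * `|a| * `|b| }.

Section subspaces.
Variables (R : realType) (L : completeNormedModType R[i]).
Implicit Types (Y Z V W : set L) (G C : set (set L)).

Definition linear_subspace Y : Prop := submod_closed (mem Y).

Definition closed_subspace Y : Prop := linear_subspace Y /\ closed Y.

(* [dim (Z / Y) = n]: the classes modulo [Y] of [e 0], ..., [e (n - 1)] form a
   basis of the quotient [Z / Y].  *)
Definition quotient_dim Y Z (n : nat) : Prop :=
  exists e : 'I_n -> L,
    [/\ forall i, Z (e i),
        forall c : 'I_n -> R[i], Y (\sum_(i < n) c i *: e i) ->
          forall i, c i = 0
      & forall z, Z z ->
          exists c : 'I_n -> R[i], Y (z - \sum_(i < n) c i *: e i)].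

Definition finite_codim Y : Prop := exists n, quotient_dim Y setT n.

Definition family_inf G : set L := \bigcap_(Y in G) Y.

Definition algebraic_sum G : set L :=
  [set x | exists n (y : 'I_n -> L),
    (forall i, exists2 Y, G Y & Y (y i)) /\ x = \sum_(i < n) y i].

Definition family_sup G : set L := closure (algebraic_sum G).

Definition complete_family G : Prop :=
  forall G', G' !=set0 -> G' `<=` G -> G (family_inf G') /\ G (family_sup G').

Definition lower_finite_gap G : Prop :=
  forall Z, G Z -> Z <> family_inf G ->
    exists Y n, [/\ G Y, Y `<=` Z, (0 < n)%N & quotient_dim Y Z n].

Definition subspace_chain C : Prop :=
  [/\ C !=set0, C `<=` closed_subspace
    & forall Y Z, C Y -> C Z -> Y `<=` Z \/ Z `<=` Y].

Definition between C W V : Prop :=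
  [/\ V `<=` W, family_inf C = V & family_sup C = W].

End subspaces.

Definition separable_space (T : topologicalType) : Prop :=
  exists2 D : set T, countable D & dense D.

Section lie.
Variables (R : realType) (L : completeNormedModType R[i]).
Variable br : {bilinear L -> L -> L}.
Implicit Types Y : set L.

Definition closed_lie_ideal Y : Prop :=
  closed_subspace Y /\ forall a x, Y x -> Y (br a x).

Definition closed_lie_subalgebra Y : Prop :=
  closed_subspace Y /\ forall x y, Y x -> Y y -> Y (br x y).

(* Both intersections are [setT] when they range over the empty family. *)
Definition P_ideals : set L :=
  family_inf [set Y | [/\ closed_lie_ideal Y, Y <> setT & finite_codim Y]].

Definition P_subalgebras : set L :=
  family_inf [set Y | [/\ closed_lie_subalgebra Y, Y <> setT & finite_codim Y]].

End lie.

(* Main.v *)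
Require Import Defs.
From mathcomp Require Import all_boot all_order all_algebra.
From mathcomp Require Import sesquilinear complex.
From mathcomp Require Import all_classical all_reals all_analysis.
From mathcomp Require Import wochoice.

Local Open Scope classical_set_scope.
Local Open Scope complex_scope.
Local Open Scope ring_scope.

(** Let [F] be the family of proper closed ideals (or subalgebras) of finite
    codimension, so that [P] is the intersection of [F].  Closed ideals, and
    closed subalgebras, are stable under arbitrary intersections; together with
    the fact that the members of [F] have finite codimension, nothing else is
    used, so both cases are instances of statements about an arbitrary class
    [good] of closed subspaces stable under intersections.

    For the chain, well-order [F] and let [C] consist of the intersections of
    the initial segments of [F]; the empty segment gives the whole space and
    the full segment gives [P].  Initial segments are linearly ordered by
    inclusion, hence so is [C].  A union of initial segments is an initial
    segment, so [C] is closed under infima.  A nonempty set of initial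
    segments has a smallest member, so every nonempty subfamily of [C] has a
    largest member, which is then its supremum.  If [Z] in [C] differs from
    [P], let [Y] be the first member of [F] that does not contain [Z]: then
    [Y `&` Z] is the intersection of the initial segment ending at [Y], and it
    is strictly smaller than [Z] with finite codimension in [Z], because
    [Z / (Y `&` Z)] embeds in [L / Y] ([finite_gapI], whence
    [exists_finite_gap_chain]).

    For the sequence, a separable metric space is Lindelof, so the open cover
    of the complement of [P] by the complements of the members of [F] has a
    countable subcover ([separable_bigcap]).  The finite intersections of the
    corresponding countable subfamily still have finite codimension and form
    the required sequence ([separable_decreasing_sequence]). *)

(** * Linear algebra modulo a subspace *)

Section linear_algebra.
Set Implicit Arguments.
Unset Strict Implicit.
Import Order.TTheory GRing.Theory Num.Theory.
Variables (R : realType) (L : completeNormedModType R[i]).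
Implicit Types Y Z : set L.

Lemma subspace0 Y : linear_subspace Y -> Y 0.
Proof. by case=> + _; rewrite inE. Qed.

Lemma subspaceZD Y a x y : linear_subspace Y -> Y x -> Y y -> Y (a *: x + y).
Proof. by case=> _ /(_ a x y); rewrite !inE; apply. Qed.

Lemma subspaceD Y x y : linear_subspace Y -> Y x -> Y y -> Y (x + y).
Proof. by move=> lY Yx Yy; rewrite -[x]scale1r; apply: subspaceZD. Qed.

Lemma subspaceZ Y a x : linear_subspace Y -> Y x -> Y (a *: x).
Proof.
move=> lY Yx; rewrite -[_ *: _]addr0.
by apply: subspaceZD => //; exact: subspace0.
Qed.

Lemma subspaceB Y x y : linear_subspace Y -> Y x -> Y y -> Y (x - y).
Proof. by move=> lY Yx Yy; rewrite addrC -scaleN1r; apply: subspaceZD. Qed.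

Lemma subspace_sum Y n (f : 'I_n -> L) :
  linear_subspace Y -> (forall i, Y (f i)) -> Y (\sum_(i < n) f i).
Proof.
move=> lY Yf; elim/big_ind: _ => //; first exact: subspace0.
by move=> *; exact: subspaceD.
Qed.

Lemma linear_subspaceI Y Z :
  linear_subspace Y -> linear_subspace Z -> linear_subspace (Y `&` Z).
Proof.
move=> lY lZ; split; first by rewrite inE; split; exact: subspace0.
move=> a x y; rewrite !inE => -[Yx Zx] [Yy Zy].
by split; exact: subspaceZD.
Qed.

Lemma linear_subspaceT : linear_subspace (@setT L).
Proof. by split=> [|a x y _ _]; rewrite inE. Qed.

(** The classes of the [e i] in [L / Y] are linearly independent. *)
Definition independent_mod Y n (e : 'I_n -> L) : Prop :=
  forall c : 'I_n -> R[i], Y (\sum_(i < n) c i *: e i) -> forall i, c i = 0.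

(** Every element of [Z] is a combination of the [e i] modulo [Y]; the [e i]
    themselves need not lie in [Z]. *)
Definition spanning_mod Y Z n (e : 'I_n -> L) : Prop :=
  forall z, Z z -> exists c : 'I_n -> R[i], Y (z - \sum_(i < n) c i *: e i).

Lemma independent_le_spanning Y Z n m (e : 'I_n -> L) (f : 'I_m -> L) :
  linear_subspace Y -> spanning_mod Y Z e -> (forall i, Z (f i)) ->
  independent_mod Y f -> (m <= n)%N.
Proof.
move=> lY span Zf indep.
(* Were [n < m], the [m x n] matrix expressing the [f i] through the [e j]
   modulo [Y] would have a nonzero left kernel vector [u], and
   [\sum_i u i *: f i] would lie in [Y]. *)
have [A YA] := choice (fun i => span (f i) (Zf i)).
rewrite leqNgt; apply/negP => ltnm.
pose M := \matrix_(i < m, j < n) A i j.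
have : kermx M != 0.
  rewrite kermx_eq0 -row_leq_rank -ltnNge.
  exact: leq_ltn_trans (rank_leq_col M) ltnm.
case/rowV0Pn => u /sub_kermxP uM0 /eqP; apply.
apply/rowP => k; rewrite mxE; apply: (indep (fun i => u 0 i)).
rewrite [X in Y X](_ : _ =
    \sum_(i < m) u 0 i *: (f i - \sum_(j < n) A i j *: e j)).
  by apply: subspace_sum => // i; apply: subspaceZ.
under [RHS]eq_bigr do rewrite scalerBr scaler_sumr.
rewrite big_split /= sumrN exchange_big /= [X in _ - X]big1 ?subr0 // => j _.
under eq_bigr do rewrite scalerA.
rewrite -scaler_suml.
have /rowP/(_ j) := uM0; rewrite !mxE => uMj.
under eq_bigr => i _ do [have -> : A i j = M i j by rewrite mxE].
by rewrite uMj scale0r.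
Qed.

(** If [Z0] is finitely generated modulo [Y], then every subspace [Z] of [Z0]
    has a finite basis modulo [Y `&` Z]: a family in [Z] of maximal size among
    those independent modulo [Y]. *)
Lemma finite_gapI_spanning Y Z0 Z n (e : 'I_n -> L) :
  linear_subspace Y -> linear_subspace Z -> Z `<=` Z0 ->
  spanning_mod Y Z0 e -> exists m, quotient_dim (Y `&` Z) Z m.
Proof.
move=> lY lZ sub span.
pose P m := `[< exists f : 'I_m -> L,
  (forall i, Z (f i)) /\ independent_mod Y f >].
have exP : exists m, P m.
  by exists 0%N; apply/asboolP; exists (fun=> 0); split=> [[]|c _ []].
have ubP m : P m -> (m <= n)%N.
  move=> /asboolP[f [Zf indep]].
  by apply: (independent_le_spanning lY span _ indep) => i; exact/sub/Zf.
case: (ex_maxnP exP ubP) => m /asboolP[f [Zf indep]] maxm.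
exists m, f; split=> // [c [Yc _]|z Zz]; first exact: indep.
have Zsum (c : 'I_m -> R[i]) : Z (\sum_(i < m) c i *: f i).
  by apply: subspace_sum => // i; exact: subspaceZ.
suff [c Yc] : exists c : 'I_m -> R[i], Y (z - \sum_(i < m) c i *: f i).
  by exists c; split => //; exact: subspaceB.
apply: contrapT => nspan.
(* A vector [z] outside the span extends [f] to a longer independent family. *)
suff /maxm : P m.+1 by rewrite ltnn.
apply/asboolP.
exists (fun i => if unlift ord0 i is Some j then f j else z); split.
  by move=> i; case: unliftP => [j|] _.
move=> c; rewrite big_ord_recl unlift_none.
under eq_bigr do rewrite liftK.
move=> Yc; have c0 : c ord0 = 0.
  apply/eqP; apply/negPn/negP => c0; apply: nspan.
  exists (fun i => - ((c ord0)^-1 * c (lift ord0 i))).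
  have := subspaceZ (c ord0)^-1 lY Yc.
  rewrite scalerDr scalerA mulVf // scale1r scaler_sumr -sumrN.
  congr (Y (_ + _)); apply: eq_bigr => i _.
  by rewrite scalerA scaleNr opprK.
move: Yc; rewrite c0 scale0r add0r => /indep c1 i.
by case: (unliftP ord0 i) => [j ->|->].
Qed.

Lemma finite_gapI Y Z : linear_subspace Y -> linear_subspace Z ->
  finite_codim Y -> ~ Z `<=` Y ->
  exists n, (0 < n)%N /\ quotient_dim (Y `&` Z) Z n.
Proof.
move=> lY lZ [k [e [_ _ span]]] nZY.
have [n dimn] := finite_gapI_spanning lY lZ (@subsetT _ Z) span.
exists n; split=> //; case: n dimn => // -[f [_ _ spanf]].
case: nZY => z /spanf[c []].
by rewrite big_ord0 subr0.
Qed.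

Lemma finite_codimT : finite_codim (@setT L).
Proof.
exists 0%N, (fun=> 0); split=> // [c _ []//|z _].
by exists (fun=> 0).
Qed.

Lemma finite_codimI Y Z : linear_subspace Y -> linear_subspace Z ->
  finite_codim Y -> finite_codim Z -> finite_codim (Y `&` Z).
Proof.
move=> lY lZ [k [e [_ _ spane]]] [n [f [_ _ spanf]]].
have [m [g [_ _ spang]]] := finite_gapI_spanning lY lZ (@subsetT _ Z) spane.
have lYZ := linear_subspaceI lY lZ.
pose h (i : 'I_(n + m)) :=
  match fintype.split i with inl j => f j | inr j => g j end.
(* [f] spans modulo [Z], and [g] spans [Z] modulo [Y `&` Z]. *)
have spanh : spanning_mod (Y `&` Z) setT h.
  move=> z _; have [c /spang[d YZcd]] := spanf z I.
  exists (fun i => match fintype.split i with inl j => c j | inr j => d j end).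
  rewrite big_split_ord /=.
  under eq_bigr => i _ do rewrite /h (unsplitK (inl i : 'I_n + 'I_m)).
  under [X in _ - (_ + X)]eq_bigr => i _ do
    rewrite /h (unsplitK (inr i : 'I_n + 'I_m)).
  by rewrite opprD addrA.
have := finite_gapI_spanning lYZ linear_subspaceT (@subsetT _ setT) spanh.
by rewrite setIT.
Qed.

End linear_algebra.

(** * Chains of intersections along a well-order *)

Section chain.
Set Implicit Arguments.
Unset Strict Implicit.
Variables (R : realType) (L : completeNormedModType R[i]).
Variables (good F : set (set L)).
Hypothesis good_subspace : good `<=` @closed_subspace R L.
Hypothesis good_inf : forall G, G `<=` good -> good (family_inf G).
Hypothesis F_good : F `<=` good.
Hypothesis F_codim : F `<=` @finite_codim R L.

Lemma family_infS (G G' : set (set L)) :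
  G `<=` G' -> family_inf G' `<=` family_inf G.
Proof. by move=> sub x Gx Y /sub; exact: Gx. Qed.

(** If the largest member of a family is a closed subspace, it is the supremum
    of the family. *)
Lemma family_sup_max (G : set (set L)) Z : closed_subspace Z -> G Z ->
  (forall Y, G Y -> Y `<=` Z) -> family_sup G = Z.
Proof.
move=> [lZ cZ] GZ maxZ; rewrite /family_sup.
suff -> : algebraic_sum G = Z by rewrite -(closure_id Z).1.
apply/seteqP; split=> [_ [n [y [Gy ->]]]|x Zx].
  by apply: subspace_sum => // i; have [Y GY] := Gy i; exact: maxZ.
by exists 1%N, (fun=> x); split=> [_|]; [exists Z|rewrite big_ord1].
Qed.

(** [C] consists of the intersections of the initial segments of [F] for a
    well-order of all subsets of [L]. *)
Lemma exists_finite_gap_chain :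
  exists C : set (set L),
    [/\ subspace_chain C, C `<=` good, complete_family C,
        lower_finite_gap C & between C setT (family_inf F)].
Proof.
have [le wo] := well_ordering_principle (set L).
have least (A : set (set L)) : A !=set0 ->
    exists2 Z, A Z & forall Y, A Y -> le Z Y.
  move=> [Y AY]; have [|Z [[AZ minZ] _]] := wo (fun Y => `[< A Y >]).
    by exists Y; apply/asboolP.
  by exists Z => [|X AX]; [exact/asboolP|apply: minZ; apply/asboolP].
have le_total Y Z : le Y Z \/ le Z Y.
  have [|X [->|->] minX] := least [set Y; Z]; first by exists Y; left.
    by left; apply: minX; right.
  by right; apply: minX; left.
have le_anti Y Z : le Y Z -> le Z Y -> Y = Z.
  move=> YZ ZY; have [|X [_ uniqX]] := wo (fun X => `[< [set Y; Z] X >]).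
    by exists Y; apply/asboolP; left.
  have lexx X' : le X' X' by case: (le_total X' X').
  have <- : X = Y.
    apply: uniqX; split; first by apply/asboolP; left.
    by move=> X' /asboolP[->|->].
  apply: uniqX; split; first by apply/asboolP; right.
  by move=> X' /asboolP[->|->].
have le_trans X Y Z : le X Y -> le Y Z -> le X Z.
  move=> XY YZ; have [|W W3 minW] := least [set W | [\/ W = X, W = Y | W = Z]].
    by exists X; constructor 1.
  have [WX WY WZ] : [/\ le W X, le W Y & le W Z].
    by split; apply: minW; [constructor 1|constructor 2|constructor 3].
  case: W3 => eqW; rewrite eqW in WX WY WZ.
  - exact: WZ.
  - by rewrite (le_anti _ _ XY WX).
  - by rewrite -(le_anti _ _ YZ WY).
(* Sets of members of [F] that are downward closed in [F]. *)
pose initial (S : set (set L)) :=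
  S `<=` F /\ forall X Y, S Y -> F X -> le X Y -> S X.
pose C := [set Z | exists2 S, initial S & Z = family_inf S].
have initialF : initial F by split.
have initial0 : initial set0 by split.
have initial_total S T : initial S -> initial T -> S `<=` T \/ T `<=` S.
  move=> [SF iS] [TF iT].
  have [|nST] := pselect (S `<=` T); first by left.
  right=> Y TY; apply: contrapT => nSY; apply: nST => X SX.
  have [/(iS Y X SX (TF _ TY))//|/(iT X Y TY (SF _ SX))//] := le_total Y X.
have Cgood : C `<=` good.
  by move=> _ [S [SF _] ->]; apply: good_inf => Y /SF/F_good.
have CF : C (family_inf F) by exists F.
have CT : C setT by exists set0 => //; rewrite /family_inf bigcap_set0.
have Cinf : family_inf C = family_inf F.
  apply/seteqP; split=> [x|x Fx]; first by apply.
  by move=> _ [S [SF _] ->] Y /SF; exact: Fx.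
exists C; split=> //.
- split; [by exists setT|by move=> Z /Cgood/good_subspace|].
  move=> _ _ [S iS ->] [T iT ->].
  by have [/family_infS|/family_infS] := initial_total _ _ iS iT; [right|left].
- move=> G [Z0 GZ0] GC; split.
    (* The union of the initial segments whose intersection is in [G]. *)
    exists [set Y | exists S, [/\ initial S, G (family_inf S) & S Y]].
      split=> [Y [S [[SF _] _ SY]]|X Y [S [iS GS SY]] FX leXY]; first exact: SF.
      by exists S; split=> //; exact: iS.2 SY _ _.
    apply/seteqP; split=> [x Gx Y [S [_ GS SY]]|x Sx Z GZ].
      exact: Gx GS _ SY.
    have [S iS eqZ] := GC _ GZ; rewrite eqZ => Y SY.
    by apply: Sx; exists S; split=> //; rewrite -eqZ.
  (* [G] has a largest member, given by the smallest initial segment: one that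
     omits the least [Y] in [F] omitted by any of the segments.  If none omits
     anything, all of them are equal to [F]. *)
  suff [Z GZ maxZ] : exists2 Z, G Z & forall Y, G Y -> Y `<=` Z.
    rewrite (@family_sup_max _ Z) //; first exact: GC.
    exact/good_subspace/Cgood/GC.
  pose out := [set Y |
    exists S, [/\ initial S, G (family_inf S), F Y & ~ S Y]].
  have [[Y0 outY0]|nout] := pselect (out !=set0).
    have [|Y [S [iS GS FY nSY]] minY] := least out; first by exists Y0.
    exists (family_inf S) => // Z GZ; have [T iT eqZ] := GC _ GZ.
    rewrite eqZ; apply: family_infS => X SX.
    apply: contrapT => nTX; apply: nSY; apply: (iS.2 Y X) => //.
    by apply: minY; exists T; split=> //; [rewrite -eqZ|exact: iS.1].
  have [S0 iS0 eqZ0] := GC _ GZ0.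
  exists Z0 => // Z GZ; have [S iS eqZ] := GC _ GZ.
  rewrite eqZ eqZ0; apply: family_infS => Y /(iS0.1) FY.
  apply: contrapT => nSY; apply: nout; exists Y, S.
  by split=> //; rewrite -eqZ.
- move=> Z CZ; rewrite Cinf => ZF; have [S iS eqZ] := CZ.
  (* The first member of [F] not containing [Z]; all earlier ones do. *)
  have [|Y [FY nZY] minY] := least [set Y | F Y /\ ~ Z `<=` Y].
    apply: contrapT => all_above; apply: ZF; apply/seteqP; split.
      move=> x Zx Y FY; apply: contrapT => nYx.
      by apply: all_above; exists Y; split=> // /(_ x Zx).
    by rewrite eqZ; exact: family_infS iS.1.
  have lY : linear_subspace Y by have [] := good_subspace (F_good FY).
  have lZ : linear_subspace Z by have [] := good_subspace (Cgood _ CZ).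
  have [n [n0 dimn]] := finite_gapI lY lZ (F_codim FY) nZY.
  exists (Y `&` Z), n; split=> //.
  exists [set X | F X /\ le X Y].
    split=> [X []//|X X' [_ XY] FX' X'X]; split=> //; exact: le_trans X'X XY.
  apply/seteqP; split=> [x [Yx Zx] X [FX XY]|x Tx].
    have [ZX|nZX] := pselect (Z `<=` X); first exact: ZX.
    by rewrite (le_anti _ _ XY (minY X (conj FX nZX))).
  split; first by apply: Tx; split=> //; case: (le_total Y Y).
  rewrite eqZ => X SX; apply: Tx; split; first exact: iS.1.
  have [YX|//] := le_total Y X; case: nZY => z.
  by rewrite eqZ; apply; exact: iS.2 SX FY YX.
- by split=> //; apply: family_sup_max => //; exact/good_subspace/Cgood.
Qed.

End chain.

(** * Countable subfamilies in separable spaces *)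

Section separable.
Set Implicit Arguments.
Unset Strict Implicit.
Import Order.TTheory GRing.Theory Num.Theory.

Lemma complex_small_radius (R : realType) (e : R[i]) : 0 < e ->
  exists k, ((k.+1%:R : R)^-1)%:C < e.
Proof.
rewrite ltcE /= => /andP[/eqP e0 e_gt0]; exists (Num.truncn (complex.Re e)^-1).
rewrite ltcE /= e0 eqxx /= -[ltRHS]invrK ltf_pV2 ?posrE ?invr_gt0//.
exact: truncnS_gt.
Qed.

(** The Lindelof property of a separable pseudometric space, in terms of
    closed sets: an intersection of closed sets is already the intersection
    of countably many of them.  The value [setT] is allowed in the sequence so
    that [F] may be empty. *)
Lemma separable_bigcap (R : realType) (T : pseudoMetricType R[i])
    (F : set (set T)) : separable_space T -> F `<=` closed ->
  exists Y : nat -> set T, (forall n, F (Y n) \/ Y n = setT) /\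
    \bigcap_n Y n = \bigcap_(Z in F) Z.
Proof.
move=> [D /countable_injP[f finj] dD] Fclosed.
pose r k : R[i] := ((k.+1%:R : R)^-1)%:C.
(* A pair [p] encodes the ball with centre [d] in [D] such that [f d = p.1],
   and with radius [r p.2]; [misses_ball p] holds of the members of [F] disjoint
   from that ball.  One such member is chosen for every pair that has some. *)
pose misses_ball (p : nat * nat) Y :=
  F Y /\ exists d, [/\ D d, f d = p.1 & ball d (r p.2) `&` Y = set0].
have /choice[Y YP] (n : nat) : exists Y, (F Y \/ Y = setT) /\
    forall p Z, unpickle n = Some p -> misses_ball p Z -> misses_ball p Y.
  case: (unpickle n) => [p|]; last by exists setT; split=> //; right.
  have [[Z pZ]|no] := pselect (exists Z, misses_ball p Z).
    exists Z; split; first by left; case: pZ.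
    by move=> _ ? [<-].
  exists setT; split; first by right.
  by move=> _ Z [<-] pZ; case: no; exists Z.
exists Y; split=> [n|]; first by have [] := YP n.
apply/seteqP; split=> [x Yx Z FZ|x Fx n _]; last first.
  by have [[/Fx|->]] := YP n.
apply: contrapT => nZx.
have /nbhs_ballP[e /= e0 xeZ] : nbhs x (~` Z).
  by apply: open_nbhs_nbhs; split=> //; apply: closed_openC; exact: Fclosed.
(* A ball of radius less than [e / 2] around a point [d] of [D] that is close
   to [x] contains [x] and avoids [Z]. *)
have [k ke] := complex_small_radius (divr_gt0 e0 (ltr0Sn _ 1)).
have r0 : 0 < r k by rewrite ltcR invr_gt0.
have [d [xd Dd]] : (ball x (r k))° `&` D !=set0.
  apply: dD; last exact: open_interior.
  by exists x; exact: nbhsx_ballx.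
have {}xd := interior_subset xd.
have ballZ : misses_ball (f d, k) Z.
  split=> //; exists d; split=> //; apply/seteqP; split=> // y [dy Zy].
  apply: (xeZ y) => //; rewrite [e]splitr.
  by apply: ball_triangle (le_ball (ltW ke) xd) (le_ball (ltW ke) dy).
have [_ [d' [Dd' /= fd' miss]]] := (YP _).2 _ _ (pickleK _) ballZ.
have eqd : d' = d by apply: finj; rewrite ?inE.
suff : (ball d (r k) `&` Y (pickle (f d, k))) x by rewrite -[in ball d]eqd miss.
by split; [exact: ball_sym|exact: Yx].
Qed.

End separable.

(** * Decreasing sequences of finite codimension *)

Section sequence.
Set Implicit Arguments.
Unset Strict Implicit.
Variables (R : realType) (L : completeNormedModType R[i]).
Variables (good F : set (set L)).
Hypothesis good_subspace : good `<=` @closed_subspace R L.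
Hypothesis good_inf : forall G, G `<=` good -> good (family_inf G).
Hypothesis F_good : F `<=` good.
Hypothesis F_codim : F `<=` @finite_codim R L.

Lemma separable_decreasing_sequence : separable_space L ->
  exists J : nat -> set L,
    [/\ forall n, good (J n) /\ finite_codim (J n),
        forall n, J n.+1 `<=` J n & \bigcap_n J n = family_inf F].
Proof.
move=> sepL; have Fclosed : F `<=` closed by move=> Y /F_good/good_subspace[].
have [Y [FY capY]] := separable_bigcap sepL Fclosed.
have goodT : good setT.
  by have := @good_inf set0 (@sub0set _ _); rewrite /family_inf bigcap_set0.
have goodI A B : good A -> good B -> good (A `&` B).
  move=> gA gB; have := @good_inf [set A; B].
  by rewrite /family_inf bigcap_setU !bigcap_set1; apply=> _ [->|->].
have good_codimY n : good (Y n) /\ finite_codim (Y n).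
  have [FYn|->] := FY n; first by split; [exact: F_good|exact: F_codim].
  by split=> //; exact: finite_codimT.
(* The empty intersection makes the first term the whole space. *)
exists (fun n => \big[setI/setT]_(k < n) Y k); split=> [n|n|].
- elim: n => [|n [gJ cJ]].
    by rewrite big_ord0; split=> //; exact: finite_codimT.
  have [gY cY] := good_codimY n.
  rewrite big_ord_recr /=; split; first exact: goodI.
  have [lJ _] := good_subspace gJ; have [lY _] := good_subspace gY.
  exact: finite_codimI.
- by rewrite big_ord_recr; exact: subIsetl.
- rewrite /family_inf -capY; apply/seteqP; split=> x Jx n _.
    by have := Jx n.+1 I; rewrite big_ord_recr => -[].
  by rewrite -bigcap_mkord => k _; exact: Jx.
Qed.

End sequence.

(** * Intersections of closed ideals and of closed subalgebras *)

Section lie_families.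
Set Implicit Arguments.
Unset Strict Implicit.
Variables (R : realType) (L : completeNormedModType R[i]).
Variable br : {bilinear L -> L -> L}.

Lemma closed_subspace_inf (G : set (set L)) :
  G `<=` @closed_subspace R L -> closed_subspace (family_inf G).
Proof.
move=> Gsub; split; last by apply: closed_bigI => Y /Gsub[].
split; first by rewrite inE => Y /Gsub[+ _]; exact: subspace0.
move=> a x y; rewrite !inE => Gx Gy Y GY.
by have [lY _] := Gsub Y GY; apply: subspaceZD; [|exact: Gx|exact: Gy].
Qed.

Lemma closed_lie_ideal_inf (G : set (set L)) :
  G `<=` closed_lie_ideal br -> closed_lie_ideal br (family_inf G).
Proof.
move=> GI; split; first by apply: closed_subspace_inf => Y /GI[].
by move=> a x Gx Y GY; have [_] := GI Y GY; apply; exact: Gx.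
Qed.

Lemma closed_lie_subalgebra_inf (G : set (set L)) :
  G `<=` closed_lie_subalgebra br -> closed_lie_subalgebra br (family_inf G).
Proof.
move=> GS; split; first by apply: closed_subspace_inf => Y /GS[].
by move=> x y Gx Gy Y GY; have [_] := GS Y GY; apply; [exact: Gx|exact: Gy].
Qed.

End lie_families.

Theorem proposition8p1 (R : realType) (L : completeNormedModType R[i])
    (br : {bilinear L -> L -> L}) (Lie : banach_lie_bracket br) :
  ((exists C : set (set L),
      [/\ subspace_chain C, C `<=` closed_lie_ideal br, complete_family C,
          lower_finite_gap C & between C setT (P_ideals br)]) /\
   (exists C : set (set L),
      [/\ subspace_chain C, C `<=` closed_lie_subalgebra br, complete_family C,
          lower_finite_gap C & between C setT (P_subalgebras br)])) /\
  (separable_space L ->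
   (exists J : nat -> set L,
      [/\ forall n, closed_lie_ideal br (J n) /\ finite_codim (J n),
          forall n, J n.+1 `<=` J n
        & \bigcap_n J n = P_ideals br]) /\
   (exists K : nat -> set L,
      [/\ forall n, closed_lie_subalgebra br (K n) /\ finite_codim (K n),
          forall n, K n.+1 `<=` K n
        & \bigcap_n K n = P_subalgebras br])).
Proof.
split; [split|move=> sepL; split].
- by apply: (exists_finite_gap_chain _ (@closed_lie_ideal_inf R L br));
    move=> Y [].
- by apply: (exists_finite_gap_chain _ (@closed_lie_subalgebra_inf R L br));
    move=> Y [].
- by apply: (separable_decreasing_sequence _ (@closed_lie_ideal_inf R L br) _ _
    sepL); move=> Y [].
- by apply: (separable_decreasing_sequence _
    (@closed_lie_subalgebra_inf R L br) _ _ sepL); move=> Y [].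
Qed.
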